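(* Let $A$ be a $p$-sealed predomain and $B$ a $p$-transparent predomain in $\mathcal{E}$. Then (1) every function $u:A\to B$ is weakly constant, i.e. $u\,x=u\,y$ for all $x,y:A$; and (2) every partial function $u:A\to \mathsf{L}B$ is partially constant, i.e. for all $x,y:A$ with $u\,x$ and $u\,y$ both defined, $u\,x=u\,y$.
   Context: $\mathcal{E}$ is a Grothendieck topos with a dominance $\Sigma$ (a classifier $\top:1\to\Sigma$ for a class of monos closed under pullback, identities and composition), reasoned about in its internal language, and $p$ is a subterminal object (proposition); in the paper $p=\langle l\rangle$ for a security level $l$. The lift is $\mathsf{L}E=\sum_{\phi:\Sigma}E^{\phi}$; for $e:\mathsf{L}E$, $e$ is defined when its first component holds. Assume the initial $\mathsf{L}$-algebra $\omega$ and final $\mathsf{L}$-coalgebra $\bar\omega$ exist, with canonical inclusion $\iota:\omega\to\bar\omega$. An object $E$ is complete if it is internally orthogonal to $\iota$ (every map $\omega\to E$ extends uniquely along $\iota$), and a predomain if $\mathsf{L}E$ is complete. $A$ is $p$-sealed if the projection $A\times p\to p$ is an isomorphism; $B$ is $p$-transparent if the unit $B\to B^{p}$ is an isomorphism. *)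

(* Defs.v *)
(* The topos E is represented by its internal language, for which
   Rocq's type theory (with funext/propext) serves as the ambient language:
   objects = types, subterminals = Prop, exponentials = function types. *)
Set Implicit Arguments.

Section Dom.
Variable Sig : Type.
Variable holds : Sig -> Prop.   (* the mono Sig >-> Omega *)
Variable top : Sig.

(* Sigma is a dominance (Rosolini), in the internal language:
   top classifies identities, Sigma is a sub-object of Omega
   (classified monos are determined by their classifying map), and
   the class of classified monos is closed under composition. *)
Definition is_dominance : Prop :=
  holds top /\
  (forall s t : Sig, (holds s <-> holds t) -> s = t) /\
  (forall (s : Sig) (Q : Prop),
     (holds s -> exists t : Sig, (holds t <-> Q)) ->
     exists u : Sig, (holds u <-> (holds s /\ Q))).

Definition Lift (E : Type) : Type := { s : Sig & holds s -> E }.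

Definition defined (E : Type) (e : Lift E) : Prop := holds (projT1 e).

Definition Lmap (E F : Type) (f : E -> F) (e : Lift E) : Lift F :=
  existT (fun s => holds s -> F) (projT1 e) (fun h => f (projT2 e h)).

Definition is_initial_alg (om : Type) (alpha : Lift om -> om) : Prop :=
  forall (X : Type) (a : Lift X -> X),
    exists! h : om -> X, forall e : Lift om, h (alpha e) = a (Lmap h e).

Definition is_final_coalg (omb : Type) (gamma : omb -> Lift omb) : Prop :=
  forall (X : Type) (c : X -> Lift X),
    exists! h : X -> omb, forall x : X, gamma (h x) = Lmap h (c x).

Definition is_canonical_incl (om omb : Type) (alpha : Lift om -> om)
  (gamma : omb -> Lift omb) (iota : om -> omb) : Prop :=
  forall e : Lift om, gamma (iota (alpha e)) = Lmap iota e.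

(* E is complete: internally orthogonal to iota *)
Definition complete (om omb : Type) (iota : om -> omb) (E : Type) : Prop :=
  forall f : om -> E, exists! g : omb -> E, forall n : om, g (iota n) = f n.

Definition predomain (om omb : Type) (iota : om -> omb) (E : Type) : Prop :=
  complete iota (Lift E).
End Dom.

Definition isIso (X Y : Type) (f : X -> Y) : Prop :=
  exists g : Y -> X, (forall x, g (f x) = x) /\ (forall y, f (g y) = y).

Definition sealed (p : Prop) (A : Type) : Prop :=
  isIso (fun z : A * p => snd z).

Definition transparent (p : Prop) (B : Type) : Prop :=
  isIso (fun (b : B) (_ : p) => b).

(* Main.v *)
Require Import Defs.
From Stdlib Require Import FunctionalExtensionality ProofIrrelevance.
Set Implicit Arguments.

(* Under the assumption [p], a [p]-sealed object is a singleton while a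
   [p]-transparent one is unchanged; so to show two elements of [B] equal we
   may assume [p], and then any two elements of [A] coincide. For partial
   maps, the two definedness witnesses are equal in the dominance because
   both hold. *)

Lemma sealed_subsingleton (p : Prop) (A : Type) :
  sealed p A -> p -> forall x y : A, x = y.
Proof.
  intros [g [g_pair _]] h x y.
  pose proof (g_pair (x, h)) as Ex; pose proof (g_pair (y, h)) as Ey; simpl in *.
  rewrite Ey in Ex; congruence.
Qed.

Lemma transparent_eq (p : Prop) (B : Type) :
  transparent p B -> forall b c : B, (p -> b = c) -> b = c.
Proof.
  intros [g [g_unit _]] b c Hbc.
  assert (E : (fun _ : p => b) = (fun _ : p => c)).
  { apply functional_extensionality; exact Hbc. }
  rewrite <- (g_unit b), <- (g_unit c); simpl; rewrite E; reflexivity.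
Qed.

Section SealedToTransparent.
Variables (p : Prop) (A B : Type).
Hypotheses (HA : sealed p A) (HB : transparent p B).

Lemma sealed_transparent_weakly_constant (u : A -> B) (x y : A) : u x = u y.
Proof.
  apply (transparent_eq HB); intro h.
  rewrite (sealed_subsingleton HA h x y); reflexivity.
Qed.

Lemma sealed_transparent_dep_constant (P : A -> Prop)
  (u : forall x : A, P x -> B) (x y : A) (hx : P x) (hy : P y) :
  u x hx = u y hy.
Proof.
  apply (transparent_eq HB); intro h.
  revert hy; rewrite <- (sealed_subsingleton HA h x y); intro hy.
  rewrite (proof_irrelevance _ hx hy); reflexivity.
Qed.

End SealedToTransparent.

Lemma Lift_eq_defined (Sig : Type) (holds : Sig -> Prop)
  (holds_inj : forall s t : Sig, (holds s <-> holds t) -> s = t)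
  (E : Type) (e e' : Lift holds E) :
  defined e -> defined e' ->
  (forall h h', projT2 e h = projT2 e' h') -> e = e'.
Proof.
  destruct e as [s f], e' as [t f']; unfold defined; simpl; intros hs ht Hval.
  assert (st : s = t) by (apply holds_inj; tauto).
  subst t; f_equal; apply functional_extensionality; intro h; apply Hval.
Qed.

Theorem mainTheorem2
  (Sig : Type) (holds : Sig -> Prop) (top : Sig)
  (Hdom : is_dominance holds top)
  (om omb : Type) (alpha : Lift holds om -> om) (gamma : omb -> Lift holds omb)
  (iota : om -> omb)
  (Hinit : is_initial_alg alpha) (Hfin : is_final_coalg gamma)
  (Hiota : is_canonical_incl alpha gamma iota)
  (p : Prop) (A B : Type)
  (HAs : sealed p A) (HAp : predomain holds iota A)
  (HBt : transparent p B) (HBp : predomain holds iota B) :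
  (forall (u : A -> B) (x y : A), u x = u y) /\
  (forall (u : A -> Lift holds B) (x y : A),
     defined (u x) -> defined (u y) -> u x = u y).
Proof.
  destruct Hdom as [_ [holds_inj _]].
  split.
  - exact (sealed_transparent_weakly_constant HAs HBt).
  - intros u x y hx hy.
    apply (Lift_eq_defined holds_inj); [exact hx | exact hy |].
    exact (sealed_transparent_dep_constant HAs HBt
             (fun z => holds (projT1 (u z))) (fun z => projT2 (u z)) x y).
Qed.
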